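(* Let $\mathcal{A}$ be a coefficient-free cluster algebra of type $A_2$ with cluster pattern $\{(\mathbf{x}_t,B_t)\}_{t\in\mathbb{T}_2}$ and initial cluster $\mathbf{x}=\mathbf{x}_{t_0}=(x_1,x_2)$. Then every cluster monomial of $\mathcal{A}$, i.e. every element $x_{1;t}^{m_1}x_{2;t}^{m_2}$ with $t\in\mathbb{T}_2$ and $m_1,m_2\in\mathbb{Z}_{\ge 0}$, is log-concave as a Laurent polynomial in $x_1,x_2$.
   Context: **Log-concavity of Laurent polynomials.** A nonzero Laurent polynomial with non-negative real coefficients $f(x_1,\dots,x_m)=\sum_{i_1=l_1}^{n_1}\cdots\sum_{i_m=l_m}^{n_m}a_{i_1,\dots,i_m}x_1^{i_1}\cdots x_m^{i_m}$ is called log-concave if for every $1\le j\le m$ and all indices with $l_j\le i_j\le n_j$ one has $$a_{i_1,\dots,i_j,\dots,i_m}^2\ \ge\ a_{i_1,\dots,i_j-1,\dots,i_m}\,a_{i_1,\dots,i_j+1,\dots,i_m},$$ where coefficients with $j$-th index equal to $l_j-1$ or $n_j+1$ are set to $0$. **Coefficient-free cluster algebras.** Write $[a]_+=\max(a,0)$. A (labeled) seed of rank $n$ is a pair $(\mathbf{x},B)$, where $\mathbf{x}=(x_1,\dots,x_n)$ is a tuple of algebraically independent generators of a field $\mathcal{F}$ of rational functions in $n$ variables over $\mathbb{Q}$, and $B=(b_{ij})\in \mathrm{Mat}_{n\times n}(\mathbb{Z})$ is skew-symmetrizable. The mutation $\mu_k(\mathbf{x},B)=(\mathbf{x}',B')$,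 $1\le k\le n$, is given by $x_i'=x_i$ for $i\ne k$, $x_k'=x_k^{-1}\big(\prod_{j}x_j^{[b_{jk}]_+}+\prod_{j}x_j^{[-b_{jk}]_+}\big)$, and $b_{ij}'=-b_{ij}$ if $i=k$ or $j=k$, $b_{ij}'=b_{ij}+[b_{ik}]_+b_{kj}+b_{ik}[-b_{kj}]_+$ otherwise. Let $\mathbb{T}_n$ be the $n$-regular tree whose edges are labeled by $1,\dots,n$ so that the $n$ edges at each vertex have distinct labels. A cluster pattern assigns to each vertex $t\in\mathbb{T}_n$ a seed $(\mathbf{x}_t,B_t)$, $\mathbf{x}_t=(x_{1;t},\dots,x_{n;t})$, such that seeds joined by an edge labeled $k$ are related by $\mu_k$. The elements $x_{i;t}$ are the cluster variables, and the cluster algebra $\mathcal{A}$ is the $\mathbb{Z}$-subalgebra of $\mathcal{F}$ generated by all of them. It is known that each $x_{i;t}$ is a Laurent polynomial in the initial cluster with non-negative integer coefficients. **Type $A_2$.** Here $n=2$, and the cluster algebra is of type $A_2$ if some exchange matrix (equivalently, every exchange matrix) of the pattern is $\pm\begin{pmatrix}0&1\\-1&0\end{pmatrix}$. **Cluster monomials.** A cluster monomial is a product of non-negative powers of cluster variables all belonging to the same cluster. *)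

(* Defs.v *)
From HB Require Import structures.
From mathcomp Require Import all_boot all_order all_algebra.
From mathcomp Require Import finmap.
From mathcomp Require Import mpoly.

Set Implicit Arguments.
Unset Strict Implicit.
Unset Printing Implicit Defensive.

Import Order.TTheory GRing.Theory Num.Theory.
Local Open Scope ring_scope.

(* A Laurent polynomial in m variables is its finitely supported family of
   coefficients, indexed by exponent vectors in Z^m. *)
Definition laurent (m : nat) (R : realDomainType) : Type :=
  {fsfun {ffun 'I_m -> int} -> R with 0}.

Definition leval (m : nat) (R : realDomainType) (F : fieldType)
    (iota : R -> F) (x : 'I_m -> F) (f : laurent m R) : F :=
  \sum_(e <- finsupp f) iota (f e) * \prod_(i < m) x i ^ e i.

Definition in_box (m : nat) (l n : 'I_m -> int) (e : {ffun 'I_m -> int}) : Prop :=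
  forall i, l i <= e i <= n i.

Definition unit_exp (m : nat) (j : 'I_m) : {ffun 'I_m -> int} :=
  [ffun k => (k == j)%:Z].

(* The bounds l, n of a presentation of f as a box sum are not determined by f,
   so the inequalities are required for every box containing the support;
   coefficients outside such a box are then 0. *)
Definition log_concave (m : nat) (R : realDomainType) (f : laurent m R) : Prop :=
  [/\ exists e, f e != 0,
      forall e, 0 <= f e
    & forall l n : 'I_m -> int,
        (forall e, f e != 0 -> in_box l n e) ->
        forall (j : 'I_m) (e : {ffun 'I_m -> int}), in_box l n e ->
          f (e - unit_exp j) * f (e + unit_exp j) <= f e ^+ 2].

(* When x is algebraically independent, the Laurent polynomial f is unique. *)
Definition log_concave_in (m : nat) (F : fieldType) (iota : rat -> F)
    (x : 'I_m -> F) (z : F) : Prop :=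
  exists f : laurent m rat, z = leval iota x f /\ log_concave f.

Definition algebraically_independent (n : nat) (F : fieldType) (iota : rat -> F)
    (x : 'I_n -> F) : Prop :=
  forall p : {mpoly rat[n]}, mmap iota x p = 0 -> p = 0.

Definition generates_field (n : nat) (F : fieldType) (iota : rat -> F)
    (x : 'I_n -> F) : Prop :=
  forall z : F, exists p q : {mpoly rat[n]},
    mmap iota x q != 0 /\ z = mmap iota x p / mmap iota x q.

Definition skew_symmetrizable (n : nat) (B : 'M[int]_n) : Prop :=
  exists d : 'rV[int]_n,
    (forall i, 0 < d 0 i) /\ (diag_mx d *m B)^T = - (diag_mx d *m B).

Definition is_seed (n : nat) (F : fieldType) (iota : rat -> F)
    (x : 'I_n -> F) (B : 'M[int]_n) : Prop :=
  [/\ algebraically_independent iota x,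
      generates_field iota x
    & skew_symmetrizable B].

Definition pospart (a : int) : int := Num.max a 0.

Definition mutate_cluster (n : nat) (F : fieldType) (k : 'I_n)
    (x : 'I_n -> F) (B : 'M[int]_n) (i : 'I_n) : F :=
  if i == k then
    (x k)^-1 * (\prod_(j < n) x j ^ pospart (B j k)
                + \prod_(j < n) x j ^ pospart (- B j k))
  else x i.

Definition mutate_matrix (n : nat) (k : 'I_n) (B : 'M[int]_n) : 'M[int]_n :=
  \matrix_(i, j)
    if (i == k) || (j == k) then - B i j
    else B i j + pospart (B i k) * B k j + B i k * pospart (- B k j).

(* The n-regular tree with edge labels in 'I_n, as the Cayley graph of the free
   product of n copies of Z/2: vertices are the words without two equal
   consecutive letters, and an edge labeled k joins w and rcons w k. *)
Definition tree (n : nat) : Type :=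
  {w : seq 'I_n | sorted (fun i j => i != j) w}.

Definition tree_edge (n : nat) (k : 'I_n) (s t : tree n) : bool :=
  (val t == rcons (val s) k) || (val s == rcons (val t) k).

Definition cluster_pattern (n : nat) (F : fieldType) (iota : rat -> F)
    (x : tree n -> 'I_n -> F) (B : tree n -> 'M[int]_n) : Prop :=
  (forall t, is_seed iota (x t) (B t)) /\
  (forall k s t, tree_edge k s t ->
     x t =1 mutate_cluster k (x s) (B s) /\ B t = mutate_matrix k (B s)).

Definition type_A2 (B : tree 2 -> 'M[int]_2) : Prop :=
  let A2 : 'M[int]_2 := delta_mx 0 1 - delta_mx 1 0 in
  exists t, B t = A2 \/ B t = - A2.

Definition cluster_monomial (n : nat) (F : fieldType)
    (x : tree n -> 'I_n -> F) (z : F) : Prop :=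
  exists (t : tree n) (m : 'I_n -> nat), z = \prod_(i < n) x t i ^+ m i.

(* Main.v *)
(** In type A2 every exchange matrix is [± [[0,1],[-1,0]]], so every mutation
    replaces [x_k] by [(1 + x_k') / x_k] and, starting from [(u, v)], the
    clusters run through the pentagon
    [u, v, (1+v)/u, (1+u+v)/(uv), (1+u)/v].
    Up to exchanging [u] and [v], every cluster monomial is therefore
    [u^p v^q (1+v)^a (1+u+v)^b] with [p], [q] integers.  Expanding in powers of
    [u], the coefficient of [u^(p+i) v^(q+j)] is [C(b,i) C(a+b-i,j)], and both
    [k |-> C(n,k)] and [n |-> C(n,k)] are log-concave. *)

Require Import Defs.
From mathcomp Require Import all_boot all_order all_algebra.
From mathcomp Require Import finmap mpoly.
From mathcomp Require Import zify ring.

Set Implicit Arguments.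
Unset Strict Implicit.
Unset Printing Implicit Defensive.

Import GRing.Theory Num.Theory.

Local Open Scope ring_scope.

(** * Log-concavity of binomial and trinomial coefficients *)

(** After multiplication by [(n - k) * k.+2], the ratios of consecutive coefficients reduce the
    claim to [(k + 1)(n - k - 1) <= (k + 2)(n - k)]. *)
Lemma bin_log_concave_r (n k : nat) :
  ('C(n, k) * 'C(n, k.+2) <= 'C(n, k.+1) ^ 2)%N.
Proof.
have [lt_nk | le_kn] := ltnP n k.+2; first by rewrite (bin_small lt_nk) muln0.
have h1 := mul_bin_left n k; have h2 := mul_bin_left n k.+1.
have c_gt0 : (0 < (n - k) * k.+2)%N by rewrite muln_gt0; lia.
rewrite -(leq_pmul2r c_gt0) mulnACA [('C(n, k) * _)%N]mulnC -h1.
rewrite [('C(n, k.+2) * _)%N]mulnC h2 mulnACA mulnn [leqRHS]mulnC.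
rewrite leq_mul2r [leqRHS]mulnC; apply/orP; right; apply: leq_mul; lia.
Qed.

(** The same device, with ratios in the upper index, leaves
    [(n + 1 - k)(n + 2) <= (n + 1)(n + 2 - k)], whose two sides differ by [k]. *)
Lemma bin_log_concave_l (n k : nat) :
  ('C(n, k) * 'C(n.+2, k) <= 'C(n.+1, k) ^ 2)%N.
Proof.
have [lt_nk | le_kn] := ltnP n k; first by rewrite (bin_small lt_nk).
have h1 := mul_bin_down n.+1 k; have h2 := mul_bin_down n.+2 k.
have c_gt0 : (0 < n.+1 * (n.+2 - k))%N by rewrite muln_gt0; lia.
rewrite -(leq_pmul2r c_gt0) mulnACA [('C(n, k) * _)%N]mulnC h1.
rewrite [('C(n.+2, k) * _)%N]mulnC -h2 mulnACA mulnn [leqRHS]mulnC.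
by rewrite leq_mul2r; apply/orP; right; nia.
Qed.

(** Truncated subtraction is harmless: it can only occur for [i > b], where the first factor is
    0. *)
Definition trinomial_coef (a b i j : nat) : nat := ('C(b, i) * 'C(a + b - i, j))%N.

Lemma trinomial_coef_log_concave_l (a b i j : nat) :
  (trinomial_coef a b i j * trinomial_coef a b i.+2 j
     <= trinomial_coef a b i.+1 j ^ 2)%N.
Proof.
rewrite /trinomial_coef expnMn mulnACA.
(* Once [i + 2 <= b], no subtraction truncates, so the upper indices of the second factor are three
   consecutive numbers. *)
have [lt_bi | le_ib] := ltnP b i.+2; first by rewrite (bin_small lt_bi) muln0.
apply: leq_mul; first exact: bin_log_concave_r.
have -> : (a + b - i = (a + b - i.+2).+2)%N by lia.
have -> : (a + b - i.+1 = (a + b - i.+2).+1)%N by lia.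
by rewrite mulnC bin_log_concave_l.
Qed.

Lemma trinomial_coef_log_concave_r (a b i j : nat) :
  (trinomial_coef a b i j * trinomial_coef a b i j.+2
     <= trinomial_coef a b i j.+1 ^ 2)%N.
Proof.
by rewrite /trinomial_coef expnMn mulnACA leq_mul ?bin_log_concave_r // mulnn.
Qed.

(** Expanding [((1 + v) + u) ^+ b] in [u] leaves [(1 + v) ^+ (a + b - i)] beside [u ^+ i], and this
    is expanded in [v]. *)
Lemma trinomial_expansion (R : comNzRingType) (u v : R) (a b : nat) :
  (1 + v) ^+ a * (1 + u + v) ^+ b =
  \sum_(i < b.+1) \sum_(j < (a + b).+1)
    (trinomial_coef a b i j)%:R * (u ^+ i * v ^+ j).
Proof.
rewrite addrAC (exprDn (1 + v) u) mulr_sumr; apply: eq_bigr => i _.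
have le_ib : (i <= b)%N by rewrite -ltnS.
rewrite mulrnAr mulrA -exprD addnBA // exprDn -mulrnAr mulr_suml.
(* The range of [j] is made independent of [i]; the added terms have a zero binomial coefficient. *)
rewrite (big_ord_widen (a + b).+1
  (fun j => 1 ^+ (a + b - i - j) * v ^+ j *+ 'C(a + b - i, j)
            * (u ^+ i *+ 'C(b, i)))); last by lia.
rewrite big_mkcond /=; apply: eq_bigr => j _.
rewrite /trinomial_coef natrM; case: ifPn => [_|].
  by rewrite expr1n mul1r -(mulr_natl (v ^+ j)) -(mulr_natl (u ^+ i)) mulrC mulrACA.
by rewrite -leqNgt => lt_j; rewrite (bin_small lt_j) mulr0 mul0r.
Qed.

(** * Evaluation and log-concavity of Laurent polynomials *)

Lemma leval_widen (m : nat) (R : realDomainType) (F : fieldType)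
    (iota : {rmorphism R -> F}) (x : 'I_m -> F) (f : laurent m R)
    (S : {fset {ffun 'I_m -> int}}) :
  (finsupp f `<=` S)%fset ->
  leval iota x f = \sum_(e <- S) iota (f e) * \prod_(i < m) x i ^ e i.
Proof.
move=> sub_fS; apply: big_fset_incl => // e _ e_notin.
by rewrite fsfun_dflt // rmorph0 mul0r.
Qed.

(** An inequality valid at every exponent vector makes the choice of box irrelevant. *)
Lemma log_concave_of_coef (m : nat) (R : realDomainType) (f : laurent m R) :
  (exists e, f e != 0) -> (forall e, 0 <= f e) ->
  (forall j e, f (e - unit_exp j) * f (e + unit_exp j) <= f e ^+ 2) ->
  log_concave f.
Proof. by move=> f_neq0 f_ge0 f_conc; split => // l n _ j e _; exact: f_conc. Qed.

(** * Shifted trinomials, with the two variables in either order *)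

Section ShiftedTrinomial.

Variables (i0 i1 : 'I_2) (p q : int) (a b : nat).
Hypothesis neq_i01 : i0 != i1.

Lemma I2_cases (k : 'I_2) : k = i0 \/ k = i1.
Proof.
move: neq_i01; case: i0 i1 k => [[|[|?]] ?] [[|[|?]] ?] [[|[|?]] ?] //= _;
  by [left; apply: val_inj | right; apply: val_inj].
Qed.

Lemma prod_I2 (F : fieldType) (g : 'I_2 -> F) : \prod_(k < 2) g k = g i0 * g i1.
Proof.
rewrite (bigD1 i0) //=; congr (_ * _); rewrite (big_pred1 i1) // => k.
by case: (I2_cases k) => -> /=; rewrite eqxx ?[i1 == i0]eq_sym ?(negPf neq_i01).
Qed.

Definition shifted_exp (ij : nat * nat) : {ffun 'I_2 -> int} :=
  [ffun k => if k == i0 then p + ij.1%:Z else q + ij.2%:Z].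

Lemma shifted_exp0 ij : shifted_exp ij i0 = p + ij.1%:Z.
Proof. by rewrite ffunE eqxx. Qed.

Lemma shifted_exp1 ij : shifted_exp ij i1 = q + ij.2%:Z.
Proof. by rewrite ffunE eq_sym (negPf neq_i01). Qed.

(** The guard is essential: the absolute values would otherwise reflect the coefficients into
    negative offsets. *)
Definition shifted_coef (e : {ffun 'I_2 -> int}) : nat :=
  if (p <= e i0) && (q <= e i1)
  then trinomial_coef a b `|e i0 - p|%N `|e i1 - q|%N else 0%N.

Lemma shifted_coefE ij : shifted_coef (shifted_exp ij) = trinomial_coef a b ij.1 ij.2.
Proof.
rewrite /shifted_coef shifted_exp0 shifted_exp1 !lerDl !lez_nat /=.
by congr trinomial_coef; lia.
Qed.

(** A full rectangle containing the support, chosen to match the double sum of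
    [trinomial_expansion]. *)
Definition shifted_index : {fset {ffun 'I_2 -> int}} :=
  [fset shifted_exp (val ij.1, val ij.2)
     | ij in [fset ij in {: 'I_b.+1 * 'I_(a + b).+1}]]%fset.

Lemma shifted_coef_supp e : shifted_coef e != 0%N -> e \in shifted_index.
Proof.
rewrite /shifted_coef; case: ifP => [/andP[le_p le_q]|]; last by rewrite eqxx.
rewrite /trinomial_coef muln_eq0 negb_or -!lt0n !bin_gt0 => /andP[lt_i lt_j].
have lt_i' : (`|e i0 - p| < b.+1)%N by lia.
have lt_j' : (`|e i1 - q| < (a + b).+1)%N by lia.
apply/imfsetP; exists (Ordinal lt_i', Ordinal lt_j'); first by rewrite !inE.
apply/ffunP => k /=; case: (I2_cases k) => ->.
  by rewrite shifted_exp0 /=; lia.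
by rewrite shifted_exp1 /=; lia.
Qed.

Definition shifted_trinomial : laurent 2 rat :=
  [fsfun e in shifted_index => (shifted_coef e)%:R | 0].

Lemma shifted_trinomialE e : shifted_trinomial e = (shifted_coef e)%:R.
Proof.
rewrite fsfunE; case: ifPn => // e_notin.
by case: eqP (@shifted_coef_supp e) e_notin => [-> // | _ /(_ isT) ->].
Qed.

Lemma shifted_coef_log_concave (j : 'I_2) (e : {ffun 'I_2 -> int}) :
  (shifted_coef (e - unit_exp j)%R * shifted_coef (e + unit_exp j)%R
     <= shifted_coef e ^ 2)%N.
Proof.
have neq_i10 : (i1 == i0) = false by rewrite eq_sym (negPf neq_i01).
have addE k : (e + unit_exp j) k = e k + (k == j)%:Z by rewrite !ffunE.
have subE k : (e - unit_exp j) k = e k - (k == j)%:Z by rewrite !ffunE.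
rewrite /shifted_coef !addE !subE.
(* If [e - unit_exp j] leaves the quadrant, the left side is 0; otherwise all three exponents lie in
   it and every guard holds. *)
case: (I2_cases j) => ->;
  rewrite ?eqxx ?(negPf neq_i01) ?neq_i10 ?subr0 ?addr0;
  (case: ifP => [/andP[le_p le_q]|//]);
  (rewrite !ifT; try by apply/andP; split; lia).
- have -> : `|(e i0 + 1 - p)%R|%N = `|(e i0 - 1 - p)%R|%N.+2 by lia.
  have -> : `|(e i0 - p)%R|%N = `|(e i0 - 1 - p)%R|%N.+1 by lia.
  exact: trinomial_coef_log_concave_l.
- have -> : `|(e i1 + 1 - q)%R|%N = `|(e i1 - 1 - q)%R|%N.+2 by lia.
  have -> : `|(e i1 - q)%R|%N = `|(e i1 - 1 - q)%R|%N.+1 by lia.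
  exact: trinomial_coef_log_concave_r.
Qed.

Lemma shifted_trinomial_log_concave : log_concave shifted_trinomial.
Proof.
apply: log_concave_of_coef => [|e|j e].
- exists (shifted_exp (0, 0)%N).
  by rewrite shifted_trinomialE shifted_coefE /trinomial_coef !bin0.
- by rewrite shifted_trinomialE ler0n.
- by rewrite !shifted_trinomialE -natrM -natrX ler_nat shifted_coef_log_concave.
Qed.

Lemma leval_shifted_trinomial (F : fieldType) (iota : {rmorphism rat -> F})
    (x : 'I_2 -> F) : x i0 != 0 -> x i1 != 0 ->
  leval iota x shifted_trinomial =
  x i0 ^ p * x i1 ^ q * ((1 + x i1) ^+ a * (1 + x i0 + x i1) ^+ b).
Proof.
move=> x0_neq0 x1_neq0.
rewrite (@leval_widen _ _ _ _ _ _ shifted_index); last first.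
  apply/fsubsetP => e; rewrite mem_finsupp shifted_trinomialE => h.
  by apply: shifted_coef_supp; apply: contra h => /eqP ->.
(* Reindexing the sum by pairs [(i, j)] requires distinct pairs to give distinct exponent
   vectors. *)
rewrite big_imfset /=; last first.
  move=> [i j] [i' j'] _ _ /ffunP eq_ij.
  have := eq_ij i0; have := eq_ij i1.
  rewrite !shifted_exp0 !shifted_exp1 /= => hj hi.
  by congr (_, _); apply: val_inj => /=; lia.
rewrite trinomial_expansion pair_big mulr_sumr /= -[RHS]big_enum /=.
rewrite [RHS](perm_big [fset ij in {: 'I_b.+1 * 'I_(a + b).+1}]%fset) /=.
  apply: eq_bigr => ij _; rewrite shifted_trinomialE shifted_coefE rmorph_nat prod_I2.
  by rewrite shifted_exp0 shifted_exp1 /= !expfzDr // -!exprnP; ring.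
by apply: uniq_perm => [||ij]; rewrite ?enum_uniq ?fset_uniq // mem_enum !inE.
Qed.

Lemma shifted_trinomial_log_concave_in (F : fieldType)
    (iota : {rmorphism rat -> F}) (x : 'I_2 -> F) (z : F) :
  x i0 != 0 -> x i1 != 0 ->
  z = x i0 ^ p * x i1 ^ q * ((1 + x i1) ^+ a * (1 + x i0 + x i1) ^+ b) ->
  log_concave_in iota x z.
Proof.
move=> x0_neq0 x1_neq0 ->; exists shifted_trinomial.
by rewrite leval_shifted_trinomial //; split=> //; exact: shifted_trinomial_log_concave.
Qed.

End ShiftedTrinomial.

(** * Propagation along the tree *)

(** Deleting last letters leads from any reduced word to the empty one; since [tree_edge] is
    symmetric, the path can be followed both ways. *)
Lemma tree_connected (n : nat) (P : tree n -> Prop) (s t : tree n) :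
  (forall k r r', tree_edge k r r' -> P r -> P r') -> P s -> P t.
Proof.
move=> step Ps.
have root_sorted : sorted (fun i j : 'I_n => i != j) [::] by [].
pose root : tree n := exist _ [::] root_sorted.
suff conn (r : tree n) : (P r -> P root) /\ (P root -> P r).
  by apply: (conn t).2; apply: (conn s).1.
case: r => w; elim/last_ind: w => [|w k IH] w_sorted.
  have -> : exist _ [::] w_sorted = root by apply: val_inj.
  by [].
have w'_sorted : sorted (fun i j : 'I_n => i != j) w.
  by move: w_sorted; rewrite -cats1 => /cat_sorted2 [].
have [to_root of_root] := IH w'_sorted.
split=> [h | /of_root]; [apply: to_root; apply: (step k _ _ _ h) | apply: (step k)];
  by rewrite /tree_edge /= eqxx ?orbT.
Qed.

(** * Nonvanishing from algebraic independence *)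

(** One rational point [w] certifies that [p] is a nonzero polynomial. This supplies the nonzero
    denominators needed for the pentagon. *)
Lemma mmap_neq0 (n : nat) (F : fieldType) (iota : rat -> F) (x : 'I_n -> F)
    (p : {mpoly rat[n]}) (w : 'I_n -> rat) :
  algebraically_independent iota x -> p.@[w] != 0 -> mmap iota x p != 0.
Proof.
by move=> indep; apply: contra => /eqP /indep ->; rewrite meval0.
Qed.

Section Independent.

Variables (F : fieldType) (iota : {rmorphism rat -> F}) (x : 'I_2 -> F).
Hypothesis indep : algebraically_independent iota x.

Lemma indep_neq0 (i : 'I_2) : x i != 0.
Proof.
have := @mmap_neq0 _ _ _ _ 'X_i (fun=> 1) indep.
by rewrite mevalXU mmapX mmap1U oner_neq0; apply.
Qed.

Lemma indep_add1_neq0 (i : 'I_2) : 1 + x i != 0.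
Proof.
have := @mmap_neq0 _ _ _ _ (1%:MP + 'X_i) (fun=> 0) indep.
rewrite mevalD mevalC mevalXU addr0 mmapD mmapC mmapX mmap1U /= rmorph1.
by apply.
Qed.

Lemma indep_add2_neq0 (i j : 'I_2) : 1 + x i + x j != 0.
Proof.
have := @mmap_neq0 _ _ _ _ (1%:MP + 'X_i + 'X_j) (fun=> 0) indep.
rewrite !mevalD mevalC !mevalXU !addr0 !mmapD mmapC !mmapX !mmap1U /= rmorph1.
by apply.
Qed.

End Independent.

(** * Mutation in type A2 *)

Definition A2_matrix : 'M[int]_2 := delta_mx 0 1 - delta_mx 1 0.

Definition is_A2 (B : 'M[int]_2) : Prop := B = A2_matrix \/ B = - A2_matrix.

(** Mutation is negation here: off-diagonal entries lie in row or column [k], and at the other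
    diagonal entry the correction terms sum to 0. *)
Lemma mutate_matrix_A2 (k : 'I_2) (B : 'M[int]_2) : is_A2 B -> is_A2 (mutate_matrix k B).
Proof.
suff E : forall B, is_A2 B -> mutate_matrix k B = - B.
  by move=> AB; rewrite E //; case: AB => ->; [right | left; rewrite opprK].
move=> {}B AB; apply/matrixP => i j; rewrite !mxE.
by case: AB => ->; rewrite !mxE; case: k i j => [[|[|?]] ?] [[|[|?]] ?] [[|[|?]] ?].
Qed.

(** The only nonzero entry of column [i] is 1 or -1, in row [j]; so one product is [x j] and the
    other 1, whichever the sign. *)
Lemma mutate_cluster_A2 (F : fieldType) (i j : 'I_2) (x : 'I_2 -> F) (B : 'M[int]_2) :
  i != j -> is_A2 B -> mutate_cluster i x B i = (1 + x j) / x i.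
Proof.
move=> neq_ij AB; rewrite /mutate_cluster eqxx mulrC !(prod_I2 neq_ij).
congr (_ / _); case: AB => ->; rewrite !mxE;
case: i j neq_ij => [[|[|?]] ?] [[|[|?]] ?] //= _;
rewrite /pospart /=; rewrite ?expr0z ?expr1z; ring.
Qed.

(** * The pentagon of clusters and its monomials *)

(** Cyclically consecutive pairs of the 5-periodic recurrence sending [(y, z)] to
    [(z, (1 + z) / y)]. *)
Definition pentagon (F : fieldType) (u v : F) : seq (F * F) :=
  [:: (u, v); (v, (1 + v) / u); ((1 + v) / u, (1 + u + v) / (u * v));
      ((1 + u + v) / (u * v), (1 + u) / v); ((1 + u) / v, u)].

Section Pentagon.

Variables (F : fieldType) (u v : F).
Hypotheses (u_neq0 : u != 0) (v_neq0 : v != 0) (u1_neq0 : 1 + u != 0).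
Hypotheses (v1_neq0 : 1 + v != 0) (uv1_neq0 : 1 + u + v != 0).

Lemma pentagon_next (y z : F) :
  (y, z) \in pentagon u v -> (z, (1 + z) / y) \in pentagon u v.
Proof.
have nz := (u_neq0, v_neq0, u1_neq0, v1_neq0, uv1_neq0).
rewrite !inE => /or4P[|||/orP[]] /eqP[-> ->]; apply/or4P.
- by apply: Or42; rewrite eqxx.
- by apply: Or43; apply/eqP; congr (_, _); field; rewrite !nz.
- by apply: Or44; apply/orP; left; apply/eqP; congr (_, _); field; rewrite !nz.
- by apply: Or44; apply/orP; right; apply/eqP; congr (_, _); field; rewrite !nz.
- by apply: Or41; apply/eqP; congr (_, _); field; rewrite !nz.
Qed.

Lemma pentagon_prev (y z : F) :
  (y, z) \in pentagon u v -> ((1 + y) / z, y) \in pentagon u v.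
Proof.
have nz := (u_neq0, v_neq0, u1_neq0, v1_neq0, uv1_neq0).
rewrite !inE => /or4P[|||/orP[]] /eqP[-> ->]; apply/or4P.
- by apply: Or44; rewrite eqxx orbT.
- by apply: Or41; apply/eqP; congr (_, _); field; rewrite !nz.
- by apply: Or42; apply/eqP; congr (_, _); field; rewrite !nz.
- by apply: Or43; apply/eqP; congr (_, _); field; rewrite !nz.
- by apply: Or44; apply/orP; left; apply/eqP; congr (_, _); field; rewrite !nz.
Qed.

End Pentagon.

Lemma pentagon_monomial_log_concave (F : fieldType) (iota : {rmorphism rat -> F})
    (x : 'I_2 -> F) (y z : F) (a b : nat) :
  x 0 != 0 -> x 1 != 0 -> (y, z) \in pentagon (x 0) (x 1) ->
  log_concave_in iota x (y ^+ a * z ^+ b).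
Proof.
move=> u_neq0 v_neq0.
have neq01 : 0 != 1 :> 'I_2 by [].
have neq10 : 1 != 0 :> 'I_2 by [].
have nz := (expf_neq0 _ u_neq0, expf_neq0 _ v_neq0).
(* In each case the shifts [p] and [q] collect the exponents of the bare variables and of the
   denominators. The last two pairs involve [1 + u] instead of [1 + v], hence [neq10]. *)
rewrite !inE => /or4P[|||/orP[]] /eqP[-> ->].
- apply: (@shifted_trinomial_log_concave_in _ _ a b 0 0 neq01) => //.
  by rewrite !expr0 !mulr1.
- apply: (@shifted_trinomial_log_concave_in _ _ (- b%:Z) a b 0 neq01) => //.
  by rewrite -exprnN -exprnP expr0 expr_div_n; field; rewrite !nz.
- apply: (@shifted_trinomial_log_concave_in _ _ (- (a + b)%N%:Z) (- b%:Z) a b neq01) => //.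
  by rewrite -!exprnN exprD !expr_div_n exprMn; field; rewrite !nz.
- apply: (@shifted_trinomial_log_concave_in _ _ (- (a + b)%N%:Z) (- a%:Z) b a neq10) => //.
  by rewrite -!exprnN exprD !expr_div_n exprMn addrAC; field; rewrite !nz.
- apply: (@shifted_trinomial_log_concave_in _ _ (- a%:Z) b a 0 neq10) => //.
  by rewrite -exprnN -exprnP expr0 expr_div_n; field; rewrite !nz.
Qed.

Theorem theorem1p3 (F : fieldType) (iota : {rmorphism rat -> F})
    (x : tree 2 -> 'I_2 -> F) (B : tree 2 -> 'M[int]_2) (t0 : tree 2)
    (pattern_xB : cluster_pattern iota x B) (A2 : type_A2 B) :
  forall z : F, cluster_monomial x z -> log_concave_in iota (x t0) z.
Proof.
have [seed mutation] := pattern_xB.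
have B_A2 t : is_A2 (B t).
  have [s Bs] := A2; apply: (@tree_connected _ (fun t => is_A2 (B t)) s t) Bs.
  by move=> k r r' /mutation[_ ->]; exact: mutate_matrix_A2.
have [indep _ _] := seed t0.
have u_neq0 := indep_neq0 indep 0; have v_neq0 := indep_neq0 indep 1.
(* The labels stay free because one turn around the pentagon exchanges them. *)
pose in_pentagon t := exists i j : 'I_2,
  i != j /\ (x t i, x t j) \in pentagon (x t0 0) (x t0 1).
have cluster_in_pentagon t : in_pentagon t.
  apply: (@tree_connected _ in_pentagon t0 t) => [k r r' /mutation[xE _]|]; last first.
    by exists 0, 1; rewrite inE eqxx.
  case=> i [j [neq_ij in_p]]; have neq_ji : j != i by rewrite eq_sym.
  (* Either mutation swaps the roles of [i] and [j]: replacing the first entry gives the next pair,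
     replacing the second gives the previous one. *)
  exists j, i; split=> //; rewrite !xE.
  case: (I2_cases neq_ij k) => ->.
    rewrite (mutate_cluster_A2 _ neq_ij (B_A2 r)) /mutate_cluster (negPf neq_ji).
    by apply: pentagon_next in_p; rewrite ?(indep_add1_neq0 indep) ?(indep_add2_neq0 indep).
  rewrite (mutate_cluster_A2 _ neq_ji (B_A2 r)) /mutate_cluster (negPf neq_ij).
  by apply: pentagon_prev in_p; rewrite ?(indep_add1_neq0 indep) ?(indep_add2_neq0 indep).
move=> z [t [m ->]].
have [i [j [neq_ij in_p]]] := cluster_in_pentagon t.
by rewrite (prod_I2 neq_ij); exact: pentagon_monomial_log_concave.
Qed.
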